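(* Let $N$ be a nontrivial normal subgroup of $B_n$ such that the restriction of the Dehornoy ordering to $N$ is discrete. Then the least positive element of $N$ is either a positive power of $\sigma_1$, or lies in $C(r)$, where $r$ is the largest integer with $3\le r\le n$ such that $N\cap B_{r-1}$ is trivial.
   Context: $B_n$ is the Artin braid group with generators $\sigma_1,\dots,\sigma_{n-1}$; $B_{m}\subset B_n$ for $m\le n$ via $\sigma_i\mapsto\sigma_i$. A word in the generators is $i$-positive if it contains only $\sigma_1,\dots,\sigma_i$ and their inverses, $\sigma_i$ occurs, and every occurrence of $\sigma_i$ has positive exponent; a braid is $i$-positive if some representative word is. The Dehornoy ordering is the left-invariant total order on $B_n$ whose positive cone consists of all braids that are $i$-positive for some $i$. For $r\ge 2$, $C(r)$ denotes the centralizer of $B_{r-1}$ in $B_r$ (viewed inside $B_n$). *)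

(* Defs.v *)
From mathcomp Require Import all_boot.
Set Implicit Arguments. Unset Strict Implicit. Unset Printing Implicit Defensive.

(* A letter (i, true) is sigma_i, (i, false) is sigma_i^{-1}; generators are
   indexed from 1. A braid word is a sequence of letters. *)
Definition letter := (nat * bool)%type.
Definition word := seq letter.

Definition in_gens (m : nat) (w : word) : bool :=
  all (fun l : letter => (0 < l.1) && (l.1 < m)) w.

Inductive beq (n : nat) : word -> word -> Prop :=
| beq_refl w : beq n w w
| beq_sym u v : beq n u v -> beq n v u
| beq_trans u v w : beq n u v -> beq n v w -> beq n u w
| beq_free a b i e : 0 < i -> i < n ->
    beq n (a ++ [:: (i, e); (i, ~~ e)] ++ b) (a ++ b)
| beq_comm a b i j : 0 < i -> i.+1 < j -> j < n ->
    beq n (a ++ [:: (i, true); (j, true)] ++ b) (a ++ [:: (j, true); (i, true)] ++ b)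
| beq_braid a b i : 0 < i -> i.+1 < n ->
    beq n (a ++ [:: (i, true); (i.+1, true); (i, true)] ++ b)
          (a ++ [:: (i.+1, true); (i, true); (i.+1, true)] ++ b).

Definition winv (w : word) : word := rev (map (fun l : letter => (l.1, ~~ l.2)) w).

Definition in_B (n m : nat) (w : word) : Prop :=
  exists w', beq n w w' /\ in_gens m w'.

Definition ipos (i : nat) (w : word) : bool :=
  [&& 0 < i,
      all (fun l : letter => (0 < l.1) && (l.1 <= i)) w,
      has (fun l : letter => l.1 == i) w &
      all (fun l : letter => (l.1 == i) ==> l.2) w].

Definition dpos (n : nat) (w : word) : Prop :=
  exists w', beq n w w' /\ exists i, ipos i w'.

Definition dlt (n : nat) (x y : word) : Prop := dpos n (winv x ++ y).
Definition dle (n : nat) (x y : word) : Prop := beq n x y \/ dlt n x y.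

Definition normal_subgroup (n : nat) (N : word -> Prop) : Prop :=
  (forall w, N w -> in_gens n w) /\
  (forall u v, in_gens n v -> beq n u v -> N u -> N v) /\
  N [::] /\
  (forall u v, N u -> N v -> N (u ++ v)) /\
  (forall u, N u -> N (winv u)) /\
  (forall g u, in_gens n g -> N u -> N (winv g ++ u ++ g)).

Definition nontrivial_sub (n : nat) (N : word -> Prop) : Prop :=
  exists w, N w /\ ~ beq n w [::].

Definition trivial_inter (n : nat) (N : word -> Prop) (m : nat) : Prop :=
  forall w, N w -> in_B n m w -> beq n w [::].

Definition least_positive (n : nat) (N : word -> Prop) (p : word) : Prop :=
  [/\ N p, dpos n p & forall q, N q -> dpos n q -> dle n p q].

(* The restriction of the Dehornoy ordering to N is discrete
   (for a left-ordered group: there is a least positive element). *)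
Definition discrete_on (n : nat) (N : word -> Prop) : Prop :=
  exists p, least_positive n N p.

Definition in_C (n r : nat) (p : word) : Prop :=
  in_B n r p /\ forall g, in_gens r.-1 g -> beq n (p ++ g) (g ++ p).

Definition largest_trivial_index (n : nat) (N : word -> Prop) (r : nat) : Prop :=
  [/\ 3 <= r <= n, trivial_inter n N r.-1 &
      forall r', r < r' <= n -> ~ trivial_inter n N r'.-1].

(* Main.v *)
(** A letter sigma_j is let act on sequences of pairs of integers by Dynnikov's
   piecewise linear formulas.  The letters of index < i do not touch position i+1,
   and sigma_i can only decrease its first entry, so from a suitable start an
   i-positive word acts nontrivially: an i-positive braid is nontrivial.

   Let the least positive element p of N be i-positive, i >= 2, and q in B_i.
   Multiplying p by elements of B_i on either side keeps it i-positive.  If q is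
   in N, then p <= qp and p <= q^-1 p, so p^-1 q p and its inverse are both
   nonnegative, whence q = 1; thus N meets B_i trivially.  If p and q do not commute,
   then p < q^-1 p q and p < q p q^-1, so c = p^-1 q^-1 p q and p^-1 q p q^-1
   are positive.  Since c is not in B_i, it is j-positive with j >= i, and so is
   q c q^-1, which is the inverse of p^-1 q p q^-1, a contradiction. *)
From Stdlib Require Import ZArith Lia Setoid Morphisms.
Require Import Defs.
From mathcomp Require Import all_boot.
Set Implicit Arguments. Unset Strict Implicit. Unset Printing Implicit Defensive.

(** * Dynnikov's action *)

Section Dynnikov.
Local Open Scope Z_scope.

(* With x^+ = max(x, 0) and x^- = min(x, 0), Dynnikov writes the first component
   as a + b^+ + (d^+ - z)^+ where z = a - b^- - c + d^+ is here [q - p]. *)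
Definition dyn (u v : Z * Z) : (Z * Z) * (Z * Z) :=
  let: (a, b) := u in let: (c, d) := v in
  let p := c + Z.min b 0 in let q := a + Z.max d 0 in
  let z := Z.max (q - p) 0 in
  ((Z.max b 0 + Z.max a p, d - z), (Z.min d 0 + Z.min c q, b + z)).

Definition dyn_inv (u v : Z * Z) : (Z * Z) * (Z * Z) :=
  let: (a, b) := u in let: (c, d) := v in
  let p := c - Z.min b 0 in let q := a - Z.max d 0 in
  let z := Z.min (q - p) 0 in
  ((Z.min a p - Z.max b 0, d + z), (Z.max c q - Z.min d 0, b - z)).

Lemma dynK u v : dyn_inv (dyn u v).1 (dyn u v).2 = (u, v).
Proof.
by case: u v => [a b] [c d]; do 2!apply: (f_equal2 pair); rewrite /=; lia.
Qed.

Lemma dyn_invK u v : dyn (dyn_inv u v).1 (dyn_inv u v).2 = (u, v).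
Proof.
by case: u v => [a b] [c d]; do 2!apply: (f_equal2 pair); rewrite /=; lia.
Qed.

Lemma dyn_sum u v : (dyn u v).1.2 + (dyn u v).2.2 = u.2 + v.2.
Proof. by case: u v => [a b] [c d] /=; lia. Qed.

(* Splitting innermost minima and maxima first and discarding the empty cells
   at once keeps the number of linear problems in the hundreds. *)
Ltac free_of_minmax x :=
  lazymatch x with
  | context [Z.max] => fail
  | context [Z.min] => fail
  | _ => idtac
  end.
Ltac split_minmax := repeat match goal with
  | |- context [Z.max ?x ?y] => free_of_minmax x; free_of_minmax y;
      destruct (Z.max_spec x y) as [[? ->]|[? ->]]; try (exfalso; lia)
  | |- context [Z.min ?x ?y] => free_of_minmax x; free_of_minmax y;
      destruct (Z.min_spec x y) as [[? ->]|[? ->]]; try (exfalso; lia)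
  end.

(** The set-theoretic Yang-Baxter equation: [s], [t], [r] perform sigma_1 sigma_2 sigma_1 on three
    adjacent pairs, and [s'], [t'], [r'] perform sigma_2 sigma_1 sigma_2. *)
Lemma dyn_braid u v w :
  let s := dyn u v in let t := dyn s.2 w in let r := dyn s.1 t.1 in
  let s' := dyn v w in let t' := dyn u s'.1 in let r' := dyn t'.2 s'.2 in
  (r, t.2) = ((t'.1, r'.1), r'.2).
Proof.
move=> s t r s' t' r'.
have e11 : r.1.1 = t'.1.1.
  by case: u v w @s @t @r @s' @t' @r' => [a b] [c d] [e f]; cbn; split_minmax; lia.
have e12 : r.1.2 = t'.1.2.
  by case: u v w @s @t @r @s' @t' @r' {e11} => [a b] [c d] [e f]; cbn; split_minmax; lia.
have e21 : r.2.1 = r'.1.1.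
  by case: u v w @s @t @r @s' @t' @r' {e11 e12} => [a b] [c d] [e f]; cbn; split_minmax; lia.
have e31 : t.2.1 = r'.2.1.
  by case: u v w @s @t @r @s' @t' @r' {e11 e12 e21} => [a b] [c d] [e f]; cbn; split_minmax; lia.
have e32 : t.2.2 = r'.2.2.
  by case: u v w @s @t @r @s' @t' @r' {e11 e12 e21 e31} => [a b] [c d] [e f]; cbn; split_minmax; lia.
have e22 : r.2.2 = r'.1.2.
  have := (dyn_sum u v, dyn_sum s.2 w, dyn_sum s.1 t.1,
           (dyn_sum v w, dyn_sum u s'.1, dyn_sum t'.2 s'.2)).
  rewrite -/s -/t -/r -/s' -/t' -/r' => -[[[h1 h2] h3] [[h4 h5] h6]].
  by clear -e12 e32 h1 h2 h3 h4 h5 h6; lia.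
clearbody r t r' t'.
move: r t r' t' e11 e12 e21 e22 e31 e32.
move=> [[? ?] [? ?]] [? [? ?]] [[? ?] [? ?]] [[? ?] ?] /=.
by move=> -> -> -> -> -> ->.
Qed.

Definition act1 (s : nat -> Z * Z) (l : letter) (k : nat) : Z * Z :=
  let t := (if l.2 then dyn else dyn_inv) (s l.1) (s l.1.+1) in
  if k == l.1 then t.1 else if k == l.1.+1 then t.2 else s k.

Definition act (w : word) (s : nat -> Z * Z) : nat -> Z * Z := foldl act1 s w.

(** Sequences are compared pointwise; this carries a relation verified inside a word through the
    remaining suffix. *)
Lemma act_ext w s t : s =1 t -> act w s =1 act w t.
Proof.
elim: w s t => //= l w IH s t e; apply: IH => k.
by rewrite /act1 !e.
Qed.

Lemma beq_act n u v : beq n u v -> forall s, act u s =1 act v s.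
Proof.
elim=> {u v} [//|u v _ IH s k|u v w _ IHu _ IHv s k|a b i e _ _|a b i j _ ij _|a b i _ _] //.
- by rewrite IH.
- by rewrite IHu IHv.
- move=> s; rewrite /act !foldl_cat /=; apply: act_ext => k.
  set t := foldl _ _ _.
  rewrite /act1 /= !eqxx !(gtn_eqF (ltnSn i)).
  case: e => /=; rewrite ?dynK ?dyn_invK /=.
    by case: eqP => [->//|_]; case: eqP => [->|].
  by case: eqP => [->//|_]; case: eqP => [->|].
- move=> s; rewrite /act !foldl_cat /=; apply: act_ext => k.
  set t := foldl _ _ _.
  have i_j : (i == j) = false by apply: ltn_eqF; apply: ltnW.
  have i1_j : (i.+1 == j) = false by apply: ltn_eqF.
  have i_j1 : (i == j.+1) = false by apply: ltn_eqF; apply/ltnW/ltnW.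
  rewrite /act1 /= !eqSS ?(eq_sym j) ?(eq_sym j.+1) ?eqSS i_j i1_j i_j1.
  case: (k =P i) => [->|_]; first by rewrite i_j i_j1.
  by case: (k =P i.+1) => [->|//]; rewrite eqSS i1_j i_j.
- move=> s; rewrite /act !foldl_cat /=; apply: act_ext => k.
  set t := foldl _ _ _.
  rewrite /act1 /= ?eqSS !eqxx.
  have ne1 m : (m == m.+1) = false by apply: ltn_eqF.
  have ne1' m : (m.+1 == m) = false by apply: gtn_eqF.
  have ne2 : (i.+2 == i) = false by apply: gtn_eqF; apply: ltnW.
  have ne2' : (i == i.+2) = false by apply: ltn_eqF; apply: ltnW.
  rewrite /= ?eqSS ?ne1 ?ne1' ?ne2 ?ne2'.
  have [-> ->] := dyn_braid (t i) (t i.+1) (t i.+2).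
  case: (k =P i) => [->|_]; first by rewrite ?eqxx ne1 ne2'.
  by case: (k == i.+1); case: (k == i.+2).
Qed.

(** Dropping the demand that sigma_i occur gives a class closed under concatenation that also
    contains the words of B_i. *)
Definition wpos (i : nat) : pred word :=
  all (fun l : letter => (0 < l.1 <= i)%N && ((l.1 == i) ==> l.2)).

Lemma iposE i w :
  ipos i w = [&& (0 < i)%N, wpos i w & has (fun l : letter => l.1 == i) w].
Proof.
have -> : wpos i w = all (fun l : letter => 0 < l.1 <= i)%N w
    && all (fun l : letter => (l.1 == i) ==> l.2) w by exact: all_predI.
by congr (_ && _); rewrite andbCA andbC.
Qed.

Lemma act1_low i l s : (l.1 < i)%N -> act1 s l i.+1 = s i.+1.
Proof. by move=> li; rewrite /act1 eqSS !gtn_eqF // ltnW. Qed.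

Lemma act1_top i s :
  (act1 s (i, true) i.+1).1 =
  Z.min (s i.+1).2 0 + Z.min (s i.+1).1 ((s i).1 + Z.max (s i.+1).2 0).
Proof.
by rewrite /act1 /= gtn_eqF // eqxx /dyn; case: (s i) (s i.+1) => [a b] [c d].
Qed.

Lemma act_wpos i w s :
  wpos i w -> (s i.+1).1 < 0 -> (act w s i.+1).1 < 0.
Proof.
elim: w s => //= -[j e] w IH s /andP[/andP[/andP[_ /= le_ji] epos] wpos_w] lt0.
apply: IH => //; case: (eqVneq j i) epos => [->|ne_ji] /=; last first.
  by rewrite act1_low // ltn_neqAle ne_ji.
by move=> ->; rewrite act1_top; lia.
Qed.

(** The second entry -1 forces the first sigma_i to push the first entry from 0 to at most -1;
    afterwards [act_wpos] keeps it negative. *)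
Lemma act_ipos i w s : ipos i w -> s i.+1 = (0, -1) -> (act w s i.+1).1 < 0.
Proof.
rewrite iposE => /and3P[_ + +] si.
elim: w s si => //= -[j e] w IH s si /andP[/andP[/andP[_ /= le_ji] epos] wpos_w].
case: (eqVneq j i) epos => [->|ne_ji] /=.
  by move=> -> _; apply: act_wpos => //; rewrite act1_top si; cbn [fst snd]; lia.
by move=> _; apply: IH => //; rewrite act1_low // ltn_neqAle ne_ji.
Qed.

Lemma ipos_not_beq_nil n i w : ipos i w -> ~ beq n w [::].
Proof.
move=> pos_w /beq_act/(_ (fun=> (0, -1)) i.+1) /= e.
by have := @act_ipos i w (fun=> (0, -1)) pos_w erefl; rewrite e.
Qed.

End Dynnikov.

(** * Calculus of braid words *)

#[export] Hint Resolve beq_refl : core.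

#[export] Instance beq_Equivalence n : Equivalence (beq n).
Proof. by split; [exact: beq_refl|exact: beq_sym|exact: beq_trans]. Qed.

Lemma beq_cat_ctx n a b u v : beq n u v -> beq n (a ++ u ++ b) (a ++ v ++ b).
Proof.
elim=> {u v} [w|u v _ IH|u v w _ IHu _ IHv|c d i e i0 ilt|c d i j i0 ij jn|c d i i0 ilt] //.
- by symmetry.
- by rewrite IHu.
- by have := beq_free (a ++ c) (d ++ b) e i0 ilt; rewrite !catA.
- by have := beq_comm (a ++ c) (d ++ b) i0 ij jn; rewrite !catA.
- by have := beq_braid (a ++ c) (d ++ b) i0 ilt; rewrite !catA.
Qed.

#[export] Instance cat_beq_Proper n :
  Proper (beq n ==> beq n ==> beq n) (@cat letter).
Proof.
move=> u u' eu v v' ev; transitivity (u' ++ v).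
  exact: (beq_cat_ctx [::] v eu).
by have := beq_cat_ctx u' [::] ev; rewrite !cats0.
Qed.

(** Free cancellation is restricted to indices in range, so a letter out of range can neither appear
    nor vanish. *)
Lemma beq_in_gens n u v : beq n u v -> in_gens n u = in_gens n v.
Proof.
elim=> {u v} [//|//|u v w _ -> _ -> //|a b i e i0 ilt|a b i j i0 ij jn|a b i i0 ilt];
  rewrite /in_gens !all_cat //=.
- by rewrite i0 ilt.
- by congr (_ && _); rewrite andbCA.
- by rewrite i0 ilt (ltnW ilt).
Qed.

Lemma winv_cat u v : winv (u ++ v) = winv v ++ winv u.
Proof. by rewrite /winv map_cat rev_cat. Qed.

Lemma winvK : involutive winv.
Proof.
move=> w; rewrite /winv map_rev revK -map_comp map_id_in // => -[i e] _ /=.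
by rewrite negbK.
Qed.

Lemma in_gens_winv m w : in_gens m (winv w) = in_gens m w.
Proof. by rewrite /in_gens /winv all_rev all_map. Qed.

Lemma in_gens_leq m m' w : m <= m' -> in_gens m w -> in_gens m' w.
Proof.
move=> le_m; apply: sub_all => l /andP[-> l_m] /=.
exact: leq_trans l_m le_m.
Qed.

Lemma beq_catV n w : in_gens n w -> beq n (w ++ winv w) [::].
Proof.
elim: w => [//|[i e] w IH].
case/andP => /andP[/= i0 ilt] /IH {}IH.
rewrite /winv /= rev_cons -cats1 -/(winv w) catA -[(i, e) :: _]cat1s IH.
exact: (beq_free [::] [::]).
Qed.

Lemma beq_catVl n w : in_gens n w -> beq n (winv w ++ w) [::].
Proof. by rewrite -in_gens_winv => /beq_catV; rewrite winvK. Qed.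

Lemma beq_catVK n g w : in_gens n g -> beq n (g ++ winv g ++ w) w.
Proof. by move=> gn; rewrite catA beq_catV. Qed.

(** * Positive braids *)

Definition pos_at (n i : nat) (w : word) : Prop :=
  exists w', beq n w w' /\ ipos i w'.

Lemma dposP n w : dpos n w <-> exists i, pos_at n i w.
Proof.
by split=> [[w' [e [i pos]]]|[i [w' [e pos]]]]; [exists i, w'|exists w'; split; [|exists i]].
Qed.

#[export] Instance pos_at_Proper n i : Proper (beq n ==> iff) (pos_at n i).
Proof.
by move=> u v e; split=> -[w [ew pos]]; exists w; split=> //; [rewrite -e|rewrite e].
Qed.

#[export] Instance dpos_Proper n : Proper (beq n ==> iff) (dpos n).
Proof.
move=> u v e; rewrite !dposP.
by split=> -[i pos]; exists i; [rewrite -e|rewrite e].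
Qed.

Lemma pos_at_not_nil n i w : pos_at n i w -> ~ beq n w [::].
Proof. by move=> [w' [e /ipos_not_beq_nil pos]]; rewrite e; exact: pos. Qed.

Lemma in_gens_wpos i w : in_gens i w -> wpos i w.
Proof.
apply: sub_all => l /andP[l0 li].
by rewrite l0 (ltnW li) (ltn_eqF li).
Qed.

Lemma ipos_in_gens i w : ipos i w -> in_gens i.+1 w.
Proof. by case/and4P. Qed.

Lemma ipos_catl i u v : wpos i u -> ipos i v -> ipos i (u ++ v).
Proof.
rewrite !iposE => wu /and3P[-> wv hv] /=.
by rewrite /wpos all_cat has_cat hv orbT andbT; apply/andP.
Qed.

Lemma ipos_catr i u v : ipos i u -> wpos i v -> ipos i (u ++ v).
Proof.
rewrite !iposE => /and3P[-> wu hu] wv /=.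
by rewrite /wpos all_cat has_cat hu andbT; apply/andP.
Qed.

Lemma pos_at_catl n i g w : in_gens i g -> pos_at n i w -> pos_at n i (g ++ w).
Proof.
move=> /in_gens_wpos wg [w' [e pos]]; exists (g ++ w').
by split; [rewrite e|exact: ipos_catl].
Qed.

Lemma pos_at_catr n i g w : in_gens i g -> pos_at n i w -> pos_at n i (w ++ g).
Proof.
move=> /in_gens_wpos wg [w' [e pos]]; exists (w' ++ g).
by split; [rewrite e|exact: ipos_catr].
Qed.

(** The larger index wins: the factor of smaller index i lies in B_j for the larger index j, and
    multiplying by it preserves j-positivity. *)
Lemma dpos_cat n u v : dpos n u -> dpos n v -> dpos n (u ++ v).
Proof.
move=> [u' [eu [i pu]]] [v' [ev [j pv]]]; rewrite eu ev.
exists (u' ++ v'); split=> //.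
case: (ltngtP i j) => [lt_ij|lt_ji|eq_ij].
- exists j; apply/ipos_catl/pv/in_gens_wpos.
  exact: in_gens_leq lt_ij (ipos_in_gens pu).
- exists i; apply/ipos_catr/in_gens_wpos => //.
  exact: in_gens_leq lt_ji (ipos_in_gens pv).
- exists i; apply: ipos_catl; last by rewrite eq_ij.
  by move: pu; rewrite iposE => /and3P[].
Qed.

Lemma dpos_not_nil n w : dpos n w -> ~ beq n w [::].
Proof. by case/dposP => i /pos_at_not_nil. Qed.

Lemma dpos_winv n w : in_gens n w -> dpos n w -> ~ dpos n (winv w).
Proof. by move=> wn pw /(dpos_cat pw)/dpos_not_nil; apply; exact: beq_catV. Qed.

Lemma ipos1_nseq w : ipos 1 w -> w = nseq (size w) (1, true).
Proof.
move=> /and4P[_ le1 _ pos]; apply/all_pred1P; move: le1 pos.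
elim: w => //= -[i e] w IH /andP[/= i1 le1] /andP[epos pos].
case: i i1 epos => [|[|i]] // _ /= epos.
by rewrite IH // andbT; case: e epos.
Qed.

(** * The least positive element *)

Section LeastPositive.
Variables (n : nat) (N : word -> Prop) (p p' : word) (i : nat).
Hypotheses (HN : normal_subgroup n N) (Hp : least_positive n N p).
Hypotheses (epp' : beq n p p') (pos_p' : ipos i p').

Let sub_gens w : N w -> in_gens n w. Proof. by case: HN => + _; apply. Qed.
Let mem_beq u v : beq n u v -> N u -> N v.
Proof.
case: HN => _ [H _] e Nu; apply: (H _ _ _ e) => //.
by rewrite -(beq_in_gens e); apply: sub_gens.
Qed.
Let mem_cat u v : N u -> N v -> N (u ++ v).
Proof. by case: HN => _ [_ [_ [H _]]]; apply: H. Qed.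
Let mem_winv u : N u -> N (winv u).
Proof. by case: HN => _ [_ [_ [_ [H _]]]]; apply: H. Qed.
Let mem_conj g u : in_gens n g -> N u -> N (winv g ++ u ++ g).
Proof. by case: HN => _ [_ [_ [_ [_ H]]]]; apply: H. Qed.

Let Np : N p. Proof. by case: Hp. Qed.
Let pn : in_gens n p. Proof. exact: sub_gens. Qed.
Let pos_p : pos_at n i p. Proof. by exists p'. Qed.

Let top_lt : i < n.
Proof.
have := sub_gens (mem_beq epp' Np).
case/and4P: pos_p' => _ _ /hasP[l lp' /eqP <-] _ /allP/(_ l lp').
by case/andP.
Qed.

Let low_gens g : in_gens i g -> in_gens n g.
Proof. exact: in_gens_leq (ltnW top_lt). Qed.

Lemma least_le q : N q -> pos_at n i q -> beq n p q \/ dpos n (winv p ++ q).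
Proof.
by case: Hp => _ _ H Nq pos_q; apply: H => //; apply/dposP; exists i.
Qed.

Lemma least_trivial_inter : trivial_inter n N i.
Proof.
move=> w Nw [q [ewq qi]]; rewrite ewq.
have Nq := mem_beq ewq Nw; have qn := sub_gens Nq.
have vqi : in_gens i (winv q) by rewrite in_gens_winv.
have trivl g : in_gens n g -> beq n p (g ++ p) -> beq n g [::].
  move=> gn e; rewrite -[g]cats0 -{1}(beq_catV pn) catA -e.
  exact: beq_catV.
case: (least_le (mem_cat Nq Np) (pos_at_catl qi pos_p)) => [/trivl -> //|d1].
case: (least_le (mem_cat (mem_winv Nq) Np) (pos_at_catl vqi pos_p)) => [e|d2].
  by rewrite -(beq_catV qn) (trivl _ _ e) ?cats0 // in_gens_winv.
(* The inverse of p^-1 q p is p^-1 q^-1 p, positive by [d2]. *)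
case: (@dpos_winv n (winv p ++ q ++ p)) => //.
  by rewrite /in_gens !all_cat -!/(in_gens n _) in_gens_winv pn qn.
by rewrite !winv_cat winvK -catA.
Qed.

Lemma least_centralizes g : in_gens i g -> beq n (p ++ g) (g ++ p).
Proof.
move=> gi; have gn := low_gens gi.
have vgi : in_gens i (winv g) by rewrite in_gens_winv.
have vgn := low_gens vgi.
have := mem_conj vgn Np; rewrite winvK => Ngpv.
case: (least_le (mem_conj gn Np)) => [|e|dc].
- exact/pos_at_catl/pos_at_catr.
- by rewrite {2}e beq_catVK.
case: (least_le Ngpv) => [|e|dd].
- exact/pos_at_catl/pos_at_catr.
- by rewrite {1}e -!catA beq_catVl ?cats0.
set c := winv p ++ winv g ++ p ++ g in dc.
have Nc : N c by apply: mem_cat (mem_winv Np) (mem_conj gn Np).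
case: (dc) => c' [ecc' [j pos_c']].
(* For j < i the commutator [c] would be a nontrivial element of N in B_i. *)
have le_ij : i <= j.
  rewrite leqNgt; apply/negP => lt_ji.
  case: (dpos_not_nil dc); apply: least_trivial_inter => //.
  by exists c'; split=> //; apply: in_gens_leq lt_ji (ipos_in_gens pos_c').
have gj := in_gens_leq le_ij gi; have vgj := in_gens_leq le_ij vgi.
(* As g lies in B_i, hence in B_j, conjugating by it keeps [c] j-positive; the result g p^-1 g^-1 p
   is inverse to the braid in [dd]. *)
have : pos_at n j (g ++ c ++ winv g).
  by apply/pos_at_catl/pos_at_catr => //; exists c'.
rewrite /c -!catA beq_catV // cats0 => pos_inv.
case: (dpos_winv _ dd).
  by rewrite /in_gens !all_cat -!/(in_gens n _) !in_gens_winv pn gn.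
by rewrite !winv_cat !winvK -!catA; apply/dposP; exists j.
Qed.

(** Maximality holds because p itself is a nontrivial element of N in B_{i+1}, hence in B_{r'-1} for
    every r' > i+1. *)
Lemma least_largest_index : 1 < i -> largest_trivial_index n N i.+1.
Proof.
move=> i1; split=> [||r' /andP[lt_ir _] triv]; first by rewrite ltnS i1.
  exact: least_trivial_inter.
apply: (pos_at_not_nil pos_p); apply: triv => //.
exists p'; split=> //; apply: in_gens_leq (ipos_in_gens pos_p').
by case: r' lt_ir.
Qed.

Lemma least_in_C : in_C n i.+1 p.
Proof.
split=> [|g]; last exact: least_centralizes.
by exists p'; split=> //; exact: ipos_in_gens.
Qed.

End LeastPositive.

Theorem theorem2p2 (n : nat) (N : word -> Prop)
  (HN : normal_subgroup n N) (Hnt : nontrivial_sub n N) (Hdisc : discrete_on n N)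
  (p : word) (Hp : least_positive n N p) :
  (exists k, 0 < k /\ beq n p (nseq k (1, true)))
  \/ (exists r, largest_trivial_index n N r /\ in_C n r p).
Proof.
have [_ [p' [epp' [i pos_p']]] _] := Hp.
(* Index 0 is excluded by [ipos], index at least 2 gives r = i+1, and index 1 leaves only letters
   sigma_1. *)
case: (ltngtP i 1) => [|i1|i_1].
- by case/and4P: (pos_p') => + _ _ _; case: i {pos_p'}.
- right; exists i.+1; split.
    exact: least_largest_index HN Hp epp' pos_p' i1.
  exact: least_in_C HN Hp epp' pos_p'.
- left; exists (size p'); rewrite i_1 in pos_p'; split.
    by case/and4P: pos_p' => _ _; case: (p').
  by rewrite -(ipos1_nseq pos_p').
Qed.
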